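(* Let $\rho>0$ be constant in space and time. Assume that the discrete velocity field is divergence free in the sense that, for every cell $C_i$ and every time $t$, $$\sum_{C_j\in\mathcal{K}_i}|\Gamma_{ij}|\,u_{ij}=0,\qquad u_{ij}=\frac{1}{|\Gamma_{ij}|}\int_{\Gamma_{ij}}\tfrac12(\mathbf{u}_i+\mathbf{u}_j)\cdot\mathbf{n}_{ij}\,dS,\qquad |\Gamma_{ij}|=\int_{\Gamma_{ij}}dS,$$ and that the semi-discrete geometric conservation law $$\frac{\partial |C_i(t)|}{\partial t}-\sum_{C_j\in\mathcal{K}_i}|\Gamma_{ij}|\,V_{ij}=0,\qquad V_{ij}=\frac{1}{|\Gamma_{ij}|}\int_{\Gamma_{ij}}\mathbf{v}\cdot\mathbf{n}_{ij}\,dS,\qquad |C_i(t)|=\int_{C_i(t)}d\mathbf{x},$$ is satisfied for every cell $C_i$ and every time $t$. Then the semi-discrete ALE finite volume scheme with the Ducros flux, $$\frac{\partial\left(|C_i(t)|\,\rho\,\mathbf{u}_i\right)}{\partial t}+\sum_{C_j\in\mathcal{K}_i}|\Gamma_{ij}|\,(u_{ij}-V_{ij})\,\tfrac12\rho\,(\mathbf{u}_i+\mathbf{u}_j)=0\qquad\text{for every cell } C_i,$$ verifies the discrete conservation law for the kinetic energy density $$\frac{\partial\left(|C_i(t)|\,\tfrac12\rho\,\mathbf{u}_i^2\right)}{\partial t}+\sum_{C_j\in\mathcal{K}_i}|\Gamma_{ij}|\,(u_{ij}-V_{ij})\,\tfrac12\rho\,\mathbf{u}_i\cdot\mathbf{u}_j=0\qquad\text{for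 every cell } C_i,$$ where $f^{\rho k}_{ij}=(u_{ij}-V_{ij})\,\tfrac12\rho\,\mathbf{u}_i\cdot\mathbf{u}_j$ is a consistent and symmetric approximation of the ALE numerical flux of the kinetic energy.
   Context: Inviscid incompressible flow without gravity or buoyancy is considered, in space dimension $d\in\{2,3\}$. The moving computational domain is partitioned at each time $t$ into finitely many moving cells $C_i(t)\subset\mathbb{R}^d$ of fixed connectivity (the topology of the mesh does not change in time). $\mathcal{K}_i$ is the set of cells adjacent to $C_i$, i.e. sharing a face with it (adjacency is symmetric). For $C_j\in\mathcal{K}_i$, $\Gamma_{ij}=\Gamma_{ji}$ is the (time-dependent) common face of $C_i$ and $C_j$, of measure $|\Gamma_{ij}|>0$, and $\mathbf{n}_{ij}=-\mathbf{n}_{ji}$ is the unit normal vector on it pointing from $C_i$ to $C_j$. $\mathbf{v}$ is the local mesh velocity, which is single-valued on faces, and $V_{ij}$ is the edge-averaged normal mesh velocity. Each cell carries one velocity vector $\mathbf{u}_i=\mathbf{u}_i(t)\in\mathbb{R}^d$; $\mathbf{u}_i^2=\mathbf{u}_i\cdot\mathbf{u}_i$. The scheme is semi-discrete: space is discretized and time is continuous, with $\mathbf{u}_i(t)$ and $|C_i(t)|$ differentiable in $t$ (so $\partial/\partial t$ is the ordinary time derivative). ''Consistent'' means that if $\mathbf{u}_i=\mathbf{u}_j=\mathbf{u}$ then $f^{\rho k}_{ij}$ equals the face-averaged exact ALE kinetic energy flux $\frac{1}{|\Gamma_{ij}|}\int_{\Gamma_{ij}}(\mathbf{u}-\mathbf{v})\cdot\mathbf{n}_{ij}\,dS\;\tfrac12\rho\,\mathbf{u}^2$.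 ''Symmetric'' means that the approximation $\tfrac12\rho\,\mathbf{u}_i\cdot\mathbf{u}_j$ of the transported quantity is invariant under exchanging $i$ and $j$, so that the flux only changes sign with the normal, $f^{\rho k}_{ij}=-f^{\rho k}_{ji}$. *)

(* Defs.v *)
From HB Require Import structures.
From mathcomp Require Import all_boot all_order all_algebra.
From mathcomp Require Import all_classical all_reals all_analysis.

Set Implicit Arguments.
Unset Strict Implicit.
Unset Printing Implicit Defensive.

Import Order.TTheory GRing.Theory Num.Theory.
Import numFieldNormedType.Exports.

Local Open Scope classical_set_scope.
Local Open Scope ring_scope.

(* The library norm on 'rV is the sup norm, so the Euclidean structure of R^d
   is introduced by hand. *)

Definition dotp (R : realType) (d : nat) (a b : 'rV[R]_d) : R :=
  (a *m b^T) ord0 ord0.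

Definition enorm (R : realType) (d : nat) (a : 'rV[R]_d) : R :=
  Num.sqrt (dotp a a).

(* Outer measure obtained from countable covers (Method I); the empty set
   always has weight 0, whatever the value of [w] there. *)

Definition cover_weight (R : realType) (T : Type) (w : set T -> \bar R)
    (B : set T) : \bar R :=
  if B == set0 then 0%E else w B.

Definition cover_outer (R : realType) (T : Type) (w : set T -> \bar R)
    (A : set T) : \bar R :=
  ereal_inf [set (\sum_(k <oo) cover_weight w (F k))%E
            | F in [set F : nat -> set T | A `<=` \bigcup_k F k]].

Section cover_outer_theory.
Context (R : realType) (T : pointedType) (w : set T -> \bar R).
Hypothesis w_ge0 : forall B, B !=set0 -> (0 <= w B)%E.

Lemma cover_weight0 : cover_weight w set0 = 0%E.
Proof. by rewrite /cover_weight eqxx. Qed.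

Lemma cover_weight_ge0 B : (0 <= cover_weight w B)%E.
Proof.
by rewrite /cover_weight; case: ifPn => // /set0P; exact: w_ge0.
Qed.

Lemma cover_outerE :
  cover_outer w = @mu_ext _ (g_sigma_algebraType [set: set T]) R (cover_weight w).
Proof.
apply/funext => A; rewrite /cover_outer /mu_ext; congr ereal_inf.
apply/seteqP; split => x /= [F FA <-]; exists F => //; last exact: FA.2.
by split => // i; exact: sub_sigma_algebra.
Qed.

Lemma cover_outer0 : cover_outer w set0 = 0%E.
Proof.
by rewrite cover_outerE; apply: mu_ext0;
  [exact: cover_weight0 | exact: cover_weight_ge0].
Qed.

Lemma cover_outer_ge0 A : (0 <= cover_outer w A)%E.
Proof. by rewrite cover_outerE; apply: mu_ext_ge0; exact: cover_weight_ge0. Qed.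

Lemma le_cover_outer : {homo cover_outer w : A B / A `<=` B >-> (A <= B)%E}.
Proof.
move=> A B AB; apply/ereal_inf_le_tmp => x [F BF <-].
by exists F => //; exact: subset_trans AB BF.
Qed.

Lemma cover_outer_sigma_subadditive : sigma_subadditive (cover_outer w).
Proof.
rewrite cover_outerE.
exact: (@mu_ext_sigma_subadditive _ (g_sigma_algebraType [set: set T]) R
  (cover_weight w) cover_weight_ge0).
Qed.

End cover_outer_theory.

Definition caratheodory_measure (R : realType) (T : pointedType)
    (mu : {outer_measure set T -> \bar R}) :
  {measure set (caratheodory_type mu) -> \bar R} := mu.

(* d-dimensional Lebesgue measure, from covers by half-open boxes; a set which
   is not a box has weight +oo (the infimum of the empty set). *)

Definition box (R : realType) (d : nat) (a b : 'rV[R]_d) : set 'rV[R]_d :=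
  [set x | forall k, a ord0 k < x ord0 k <= b ord0 k].

Definition box_weight (R : realType) (d : nat) (B : set 'rV[R]_d) : \bar R :=
  ereal_inf [set (\prod_(k < d) (ab.2 ord0 k - ab.1 ord0 k))%:E
            | ab in [set ab : 'rV[R]_d * 'rV[R]_d |
                (forall k, ab.1 ord0 k <= ab.2 ord0 k) /\ B = box ab.1 ab.2]].

Definition lebesgue_outer (R : realType) (d : nat) :
  set 'rV[R]_d -> \bar R := cover_outer (@box_weight R d).

Lemma box_weight_ge0 (R : realType) (d : nat) (B : set 'rV[R]_d) :
  (0 <= box_weight B)%E.
Proof.
apply: le_ereal_inf_tmp => _ [[a b] /= [ab _] <-].
by rewrite lee_fin; apply: prodr_ge0 => k _; rewrite subr_ge0.
Qed.

HB.instance Definition _ (R : realType) (d : nat) :=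
  isOuterMeasure.Build R 'rV[R]_d (@lebesgue_outer R d)
    (cover_outer0 (fun B _ => box_weight_ge0 B))
    (cover_outer_ge0 (fun B _ => box_weight_ge0 B))
    (@le_cover_outer R 'rV[R]_d (@box_weight R d))
    (cover_outer_sigma_subadditive (fun B _ => box_weight_ge0 B)).

Definition lebesgue_rV (R : realType) (d : nat) :
    {measure set (caratheodory_type (@lebesgue_outer R d)) -> \bar R} :=
  caratheodory_measure (@lebesgue_outer R d).

(* s-dimensional Hausdorff measure on R^d for the Euclidean distance, with the
   normalization that makes it the Lebesgue measure of s-dimensional flat
   pieces (length for s = 1, area for s = 2). *)

Definition diameter (R : realType) (d : nat) (B : set 'rV[R]_d) : \bar R :=
  ereal_sup [set (enorm (xy.1 - xy.2))%:E | xy in B `*` B].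

Fixpoint unit_ball_volume (R : realType) (s : nat) : R :=
  match s with
  | 0 => 1
  | 1 => 2
  | s'.+2 => 2 * pi / s'.+2%:R * unit_ball_volume R s'
  end.

Definition hausdorff_weight (R : realType) (d s : nat) (delta : R)
    (B : set 'rV[R]_d) : \bar R :=
  if (diameter B <= delta%:E)%E
  then (unit_ball_volume R s * (fine (diameter B) / 2) ^+ s)%:E
  else +oo%E.

Definition hausdorff_outer (R : realType) (d s : nat) (A : set 'rV[R]_d) :
    \bar R :=
  ereal_sup [set cover_outer (@hausdorff_weight R d s delta) A
            | delta in [set delta : R | 0 < delta]].

Lemma unit_ball_volume_ge0 (R : realType) (s : nat) :
  0 <= unit_ball_volume R s.
Proof.
have [] : 0 <= unit_ball_volume R s /\ 0 <= unit_ball_volume R s.+1; last by [].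
elim: s => [|s [h1 h2]]; first by split.
split=> //; rewrite [unit_ball_volume _ _.+2]/=; apply: mulr_ge0 => //.
by rewrite divr_ge0// mulr_ge0// pi_ge0.
Qed.

Lemma hausdorff_weight_ge0 (R : realType) (d s : nat) (delta : R)
    (B : set 'rV[R]_d) :
  B !=set0 -> (0 <= hausdorff_weight s delta B)%E.
Proof.
move=> [x Bx]; rewrite /hausdorff_weight; case: ifPn => // _.
rewrite lee_fin mulr_ge0 ?unit_ball_volume_ge0// exprn_ge0// divr_ge0//.
rewrite fine_ge0//; apply: (@le_trans _ _ (enorm (x - x))%:E).
  by rewrite lee_fin sqrtr_ge0.
by apply: ereal_sup_ubound; exists (x, x).
Qed.

Section hausdorff_outer_theory.
Context (R : realType) (d s : nat).
Local Notation mu := (@hausdorff_outer R d s).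

Let w_ge0 (delta : R) (B : set 'rV[R]_d) (B0 : B !=set0) :=
  hausdorff_weight_ge0 s delta B0.

Lemma hausdorff_outer0 : mu set0 = 0%E.
Proof.
apply/eqP; rewrite eq_le; apply/andP; split.
  apply: ge_ereal_sup => _ [delta d0 <-].
  by rewrite (cover_outer0 (@w_ge0 _)).
apply: le_trans (cover_outer_ge0 (@w_ge0 1) set0) _.
by apply: ereal_sup_ubound; exists 1 => //=.
Qed.

Lemma hausdorff_outer_ge0 A : (0 <= mu A)%E.
Proof.
apply: le_trans (cover_outer_ge0 (@w_ge0 1) A) _.
by apply: ereal_sup_ubound; exists 1 => //=.
Qed.

Lemma le_hausdorff_outer : {homo mu : A B / A `<=` B >-> (A <= B)%E}.
Proof.
move=> A B AB; apply: ge_ereal_sup => _ [delta d0 <-].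
apply: le_trans (le_cover_outer _ AB) _.
by apply: ereal_sup_ubound; exists delta.
Qed.

Lemma hausdorff_outer_sigma_subadditive : sigma_subadditive mu.
Proof.
move=> F; apply: ge_ereal_sup => _ [delta d0 <-].
apply: le_trans (cover_outer_sigma_subadditive (@w_ge0 _) _) _.
apply: lee_nneseries => [k _ _|k _]; first exact: cover_outer_ge0 (@w_ge0 _) _.
by apply: ereal_sup_ubound; exists delta.
Qed.

End hausdorff_outer_theory.

HB.instance Definition _ (R : realType) (d s : nat) :=
  isOuterMeasure.Build R 'rV[R]_d (@hausdorff_outer R d s)
    (hausdorff_outer0 R d s)
    (@hausdorff_outer_ge0 R d s)
    (@le_hausdorff_outer R d s)
    (@hausdorff_outer_sigma_subadditive R d s).

Definition surface_measure (R : realType) (d : nat) :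
    {measure set (caratheodory_type (@hausdorff_outer R d d.-1)) -> \bar R} :=
  caratheodory_measure (@hausdorff_outer R d d.-1).

(* A mesh of compact cells with pairwise disjoint interiors, over a set [I] of
   times, carrying its face normals and the local mesh velocity.  The
   adjacency relation does not depend on time: the connectivity is fixed. *)

Record moving_mesh (R : realType) (d : nat) (J : finType) (I : set R) :=
  MovingMesh {
  domain : R -> set 'rV[R]_d ;
  cell : R -> J -> set 'rV[R]_d ;
  adj : rel J ;
  normal : R -> J -> J -> 'rV[R]_d -> 'rV[R]_d ;
  mesh_velocity : R -> 'rV[R]_d -> 'rV[R]_d ;
  face := fun (t : R) (i j : J) => cell t i `&` cell t j ;

  domainE : forall t, I t -> domain t = \bigcup_(i in [set: J]) cell t i ;
  cell_compact : forall t i, I t -> compact (cell t i) ;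
  cell_disjoint : forall t i j, I t -> i != j ->
    (cell t i)° `&` (cell t j)° = set0 ;
  adjE : forall t i j, I t ->
    adj i j = (i != j) && (0 < surface_measure R d (face t i j))%E ;

  face_measurable : forall t i j, I t -> adj i j ->
    measurable (face t i j : set (caratheodory_type (@hausdorff_outer R d d.-1))) ;
  face_finite : forall t i j, I t -> adj i j ->
    (surface_measure R d (face t i j) < +oo)%E ;

  normal_unit : forall t i j x, I t -> adj i j -> face t i j x ->
    enorm (normal t i j x) = 1 ;
  normal_opp : forall t i j x, I t -> adj i j -> face t i j x ->
    normal t i j x = - normal t j i x ;
  (* Leaving almost every point of the face on the side of the normal one
     enters cell [j], and on the opposite side one enters cell [i]; this
     determines the unit normal up to a negligible set (edges, corners). *)
  normal_points : forall t i j, I t -> adj i j ->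
    {ae surface_measure R d, forall x, face t i j x -> forall y : 'rV[R]_d,
      (0 < dotp y (normal t i j x) ->
        \forall h \near 0^'+, cell t j (x + h *: y)) /\
      (dotp y (normal t i j x) < 0 ->
        \forall h \near 0^'+, cell t i (x + h *: y))} ;
  normal_measurable : forall t i j k, I t -> adj i j ->
    measurable_fun
      (face t i j : set (caratheodory_type (@hausdorff_outer R d d.-1)))
      (fun x => normal t i j x ord0 k) ;
  mesh_velocity_integrable : forall t i j, I t -> adj i j ->
    (surface_measure R d).-integrable (face t i j)
      (fun x => (dotp (mesh_velocity t x) (normal t i j x))%:E)
}.

Section scheme.
Context (R : realType) (d : nat) (J : finType) (I : set R).
Variable M : moving_mesh d J I.
Implicit Types (t rho : R) (i j : J) (a b : 'rV[R]_d) (u : R -> J -> 'rV[R]_d).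

Definition cell_volume t i : R := \int[lebesgue_rV R d]_(x in cell M t i) 1.

Definition face_integral t i j (g : 'rV[R]_d -> R) : R :=
  \int[surface_measure R d]_(x in face M t i j) g x.

Definition face_area t i j : R := face_integral t i j (fun=> 1).

Definition face_average t i j (g : 'rV[R]_d -> R) : R :=
  (face_area t i j)^-1 * face_integral t i j g.

Definition face_velocity t i j a b : R :=
  face_average t i j (fun x => dotp (2^-1 *: (a + b)) (normal M t i j x)).

Definition face_mesh_velocity t i j : R :=
  face_average t i j (fun x => dotp (mesh_velocity M t x) (normal M t i j x)).

Definition divergence_free u : Prop := forall t i, I t ->
  \sum_(j | adj M i j) face_area t i j * face_velocity t i j (u t i) (u t j) = 0.

Definition geometric_conservation_law : Prop := forall t i, I t ->
  derive1 (cell_volume ^~ i) t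
  - \sum_(j | adj M i j) face_area t i j * face_mesh_velocity t i j = 0.

Definition ducros_scheme rho u : Prop := forall t i, I t ->
  derive1 (fun s => (cell_volume s i * rho) *: u s i) t
  + \sum_(j | adj M i j)
      (face_area t i j
       * (face_velocity t i j (u t i) (u t j) - face_mesh_velocity t i j))
      *: ((2^-1 * rho) *: (u t i + u t j)) = 0.

Definition ke_density rho a b : R := 2^-1 * rho * dotp a b.

(* The numerical flux as a function of the two adjacent states [a], [b]. *)
Definition ke_flux rho t i j a b : R :=
  (face_velocity t i j a b - face_mesh_velocity t i j) * ke_density rho a b.

Definition exact_ke_flux rho t i j a : R :=
  face_average t i j
    (fun x => dotp (a - mesh_velocity M t x) (normal M t i j x))
  * (2^-1 * rho * dotp a a).

Definition consistent_ke_flux rho (f : R -> J -> J -> 'rV[R]_d -> 'rV[R]_d -> R) :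
    Prop :=
  forall t i j a, I t -> adj M i j -> f t i j a a = exact_ke_flux rho t i j a.

Definition antisymmetric_flux (f : R -> J -> J -> 'rV[R]_d -> 'rV[R]_d -> R) :
    Prop :=
  forall t i j a b, I t -> adj M i j -> f t i j a b = - f t j i b a.

Definition kinetic_energy_law rho u : Prop := forall t i, I t ->
  derivable (fun s => cell_volume s i * (2^-1 * rho * dotp (u s i) (u s i))) t 1
  /\ derive1 (fun s => cell_volume s i * (2^-1 * rho * dotp (u s i) (u s i))) t
     + \sum_(j | adj M i j)
         face_area t i j * ke_flux rho t i j (u t i) (u t j) = 0.

End scheme.

(* Main.v *)
Require Import Defs.
From HB Require Import structures.
From mathcomp Require Import all_boot all_order all_algebra.
From mathcomp Require Import all_classical all_reals all_analysis.
From mathcomp Require Import ring.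

Set Implicit Arguments.
Unset Strict Implicit.
Unset Printing Implicit Defensive.

Import Order.TTheory GRing.Theory Num.Theory.
Import numFieldNormedType.Exports.
Local Open Scope classical_set_scope.
Local Open Scope ring_scope.

(** The kinetic energy is the momentum balance tested against the velocity.
    With [V] the volume of cell [i], the product rule gives
    [(V rho/2 |u|^2)' = u . (V rho u)' - rho/2 |u|^2 V'], so dotting the Ducros
    scheme with [u_i] produces the fluxes
    [F_ij rho/2 (|u_i|^2 + u_i . u_j)] where [F_ij = |Gamma_ij| (u_ij - V_ij)].
    The part carrying [u_i . u_j] is the kinetic energy flux.  The part carrying
    [|u_i|^2] has a factor which does not depend on [j], hence sums to
    [rho/2 |u_i|^2] times [sum_j F_ij].  Incompressibility removes the [u_ij]
    from this sum, and the geometric conservation law gives it the value [- V'],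
    which is what compensates the [- rho/2 |u|^2 V'] of the product rule
    ([kinetic_energy_balance]).

    Consistency and antisymmetry are statements about face averages: consistency
    is linearity of the average, antisymmetry is [n_ij = - n_ji] on the common
    face.  As integrals are only linear on integrable functions, both rest on
    the integrability over a face of the normal components of the mesh velocity,
    which is part of the definition of a mesh, and of a constant vector, which
    holds because the unit normal is bounded and the face has finite measure
    ([integrable_dotp_normal]). *)

(** * Euclidean scalar product *)

Section scalar_product.
Context {R : realType} {d : nat}.
Implicit Types a b c : 'rV[R]_d.

Lemma dotpE a b : dotp a b = \sum_k a ord0 k * b ord0 k.
Proof. by rewrite /dotp mxE; under eq_bigr do rewrite mxE. Qed.

Lemma dotpC a b : dotp a b = dotp b a.
Proof. by rewrite !dotpE; under eq_bigr do rewrite mulrC. Qed.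

Lemma dotpDl a b c : dotp (a + b) c = dotp a c + dotp b c.
Proof. by rewrite /dotp mulmxDl mxE. Qed.

Lemma dotpNl a b : dotp (- a) b = - dotp a b.
Proof. by rewrite /dotp mulNmx mxE. Qed.

Lemma dotpNr a b : dotp a (- b) = - dotp a b.
Proof. by rewrite dotpC dotpNl dotpC. Qed.

Lemma dotpZl (k : R) a b : dotp (k *: a) b = k * dotp a b.
Proof. by rewrite /dotp -scalemxAl mxE. Qed.

Lemma dotp_suml (J : finType) (P : pred J) (f : J -> 'rV[R]_d) b :
  dotp (\sum_(j | P j) f j) b = \sum_(j | P j) dotp (f j) b.
Proof. by rewrite /dotp mulmx_suml summxE. Qed.

Lemma coord_le_enorm a k : `|a ord0 k| <= enorm a.
Proof.
rewrite /enorm -sqrtr_sqr; apply: ler_wsqrtr.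
rewrite dotpE (bigD1 k)//= expr2 lerDl.
by apply: sumr_ge0 => l _; rewrite -expr2 sqr_ge0.
Qed.

End scalar_product.

(** * Product rules for vector-valued functions of time *)

Section product_rules.
Context {R : realType} {d : nat}.
Implicit Types (f : R -> R) (v w : R -> 'rV[R]_d) (t : R).

Lemma derivable_coord w t k :
  derivable w t 1 -> derivable (fun s => w s ord0 k) t 1.
Proof. by move/derivable_mxP. Qed.

Lemma derive_coord w t k :
  derivable w t 1 -> 'D_1 (fun s => w s ord0 k) t = ('D_1 w t) ord0 k.
Proof. by move=> dw; rewrite [in RHS]derive_mx// mxE. Qed.

(** The scalar field [f] varies with time, so that scaling is not a constant
    linear map; the rule is read off coordinatewise. *)
Lemma derive_scale f w t : derivable f t 1 -> derivable w t 1 ->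
  'D_1 (fun s => f s *: w s) t = f t *: 'D_1 w t + 'D_1 f t *: w t.
Proof.
move=> df dw.
have E k : (fun s => (f s *: w s) ord0 k) = f * (fun s => w s ord0 k).
  by apply/funext => s; rewrite mxE.
have dfw : derivable (fun s => f s *: w s) t 1.
  apply/derivable_mxP => i k; rewrite ord1 E.
  by apply: derivableM => //; exact: derivable_coord.
rewrite derive_mx//; apply/rowP => k; rewrite mxE E.
rewrite deriveM//; last exact: derivable_coord.
by rewrite derive_coord// !mxE; congr (_ + _); exact: mulrC.
Qed.

Lemma is_derive_dotp v w t : derivable v t 1 -> derivable w t 1 ->
  is_derive t 1 (fun s => dotp (v s) (w s))
    (dotp ('D_1 v t) (w t) + dotp (v t) ('D_1 w t)).
Proof.
move=> dv dw.
have -> : (fun s => dotp (v s) (w s)) =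
    \sum_(k < d) ((fun s => v s ord0 k) * (fun s => w s ord0 k)).
  by apply/funext => s; rewrite dotpE fct_sumE.
rewrite !dotpE -big_split/=; apply: is_derive_sum => k.
have /derivableP dvk : derivable (fun s => v s ord0 k) t 1.
  exact: derivable_coord.
have /derivableP dwk : derivable (fun s => w s ord0 k) t 1.
  exact: derivable_coord.
apply: is_derive_eq.
rewrite !derive_coord// addrC; congr (_ + _); exact: mulrC.
Qed.

End product_rules.

(** * The kinetic energy balance *)

Section balance.
Context {R : realType} {d : nat} {J : finType}.

(** The cancellation of the scheme, freed from the mesh: [A] stands for the face
    areas, [un] and [vn] for the normal velocities of fluid and mesh, and [W] for
    the velocities of the neighbours of a cell with velocity [w]. *)
Lemma kinetic_energy_balance (V : R -> R) (w : R -> 'rV[R]_d) (rho t : R)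
    (P : pred J) (A un vn : J -> R) (W : J -> 'rV[R]_d) :
  derivable V t 1 -> derivable w t 1 ->
  \sum_(j | P j) A j * un j = 0 ->
  'D_1 V t - \sum_(j | P j) A j * vn j = 0 ->
  'D_1 (fun s => (V s * rho) *: w s) t
    + \sum_(j | P j) (A j * (un j - vn j)) *: ((2^-1 * rho) *: (w t + W j)) = 0 ->
  derivable (fun s => V s * (2^-1 * rho * dotp (w s) (w s))) t 1 /\
  'D_1 (fun s => V s * (2^-1 * rho * dotp (w s) (w s))) t
    + \sum_(j | P j) A j * ((un j - vn j) * (2^-1 * rho * dotp (w t) (W j))) = 0.
Proof.
move=> dV dw div gcl.
have dVrho : is_derive t 1 (fun s => V s * rho) (rho * 'D_1 V t).
  have -> : (fun s => V s * rho) = rho \*: V.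
    by apply/funext => s; exact: mulrC.
  by apply: DeriveDef; [exact: derivableZ | rewrite deriveZ].
have dE : is_derive t 1 (fun s => V s * (2^-1 * rho * dotp (w s) (w s)))
    (V t * (rho * dotp ('D_1 w t) (w t))
     + 2^-1 * rho * dotp (w t) (w t) * 'D_1 V t).
  have /derivableP dV' := dV.
  have dww := is_derive_dotp dw dw.
  have -> : (fun s => V s * (2^-1 * rho * dotp (w s) (w s))) =
      V * ((2^-1 * rho) \*: (fun s => dotp (w s) (w s))) by [].
  apply: is_derive_eq; rewrite (dotpC (w t) ('D_1 w t)).
  by do 2 rewrite /GRing.scale/=; field.
rewrite derive_scale//.
move=> /(congr1 (fun a => dotp a (w t))).
rewrite !dotpDl !dotpZl derive_val dotp_suml.
rewrite (_ : dotp 0 (w t) = 0); last by rewrite -(scale0r 0) dotpZl mul0r.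
move=> momentum; split; first by case: dE.
rewrite derive_val.
(* The half of the flux carried by [w] has a factor independent of [j], so that
   the two conservation hypotheses can be applied to the remaining sum. *)
have flux_split :
  \sum_(j | P j) dotp ((A j * (un j - vn j)) *: (2^-1 * rho *: (w t + W j))) (w t)
  = 2^-1 * rho * dotp (w t) (w t)
      * (\sum_(j | P j) A j * un j - \sum_(j | P j) A j * vn j)
    + \sum_(j | P j) A j * ((un j - vn j) * (2^-1 * rho * dotp (w t) (W j))).
  rewrite -sumrB mulr_sumr -big_split/=; apply: eq_bigr => j _.
  by rewrite !dotpZl dotpDl (dotpC (W j)); ring.
rewrite flux_split div -(subr0_eq gcl) in momentum.
rewrite -[RHS]momentum.
by field.
Qed.

End balance.

(** * Averages over the faces of a moving mesh *)

Section faces.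
Context {R : realType} {d : nat} {J : finType} {I : set R}.
Variable M : moving_mesh d J I.
Implicit Types (t : R) (i j : J) (a : 'rV[R]_d) (g : 'rV[R]_d -> R).

Lemma faceC t i j : face M t i j = face M t j i.
Proof. exact: setIC. Qed.

Lemma adjC t i j : I t -> adj M i j = adj M j i.
Proof. by move=> It; rewrite !(adjE M _ _ It) eq_sym faceC. Qed.

(** Each coordinate of the unit normal is bounded by [1] on a face of finite
    area. *)
Lemma integrable_dotp_normal t i j a : I t -> adj M i j ->
  (surface_measure R d).-integrable (face M t i j)
    (EFin \o (fun x => dotp a (normal M t i j x))).
Proof.
move=> It ij; have mF := face_measurable It ij.
have -> : EFin \o (fun x => dotp a (normal M t i j x)) =
    (fun x => \sum_(k < d) ((a ord0 k)%:E * (normal M t i j x ord0 k)%:E))%E.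
  by apply/funext => x /=; rewrite dotpE -sumEFin.
apply: integrable_sum => // k _; apply: integrableZl => //.
apply: (measurable_bounded_integrable mF (face_finite It ij)
  (normal_measurable k It ij)).
exists 1; split; first exact: num_real.
move=> y y1 x Fx; apply: le_trans (coord_le_enorm _ _) _.
by rewrite (normal_unit It ij Fx) ltW.
Qed.

Lemma face_averageB t i j g1 g2 : I t -> adj M i j ->
  (surface_measure R d).-integrable (face M t i j) (EFin \o g1) ->
  (surface_measure R d).-integrable (face M t i j) (EFin \o g2) ->
  face_average M t i j (fun x => g1 x - g2 x) =
  face_average M t i j g1 - face_average M t i j g2.
Proof.
move=> It ij i1 i2.
rewrite /face_average /face_integral RintegralB ?mulrBr//.
exact: face_measurable.
Qed.

Lemma face_average_opp t i j g1 g2 : I t -> adj M i j ->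
  (surface_measure R d).-integrable (face M t i j) (EFin \o g1) ->
  (forall x, face M t i j x -> g2 x = - g1 x) ->
  face_average M t j i g2 = - face_average M t i j g1.
Proof.
move=> It ij i1 g21.
rewrite /face_average /face_area /face_integral faceC -mulrN; congr (_ * _).
rewrite -mulN1r -RintegralZl//; last exact: face_measurable.
by apply: eq_Rintegral => x /set_mem Fx; rewrite g21// mulN1r.
Qed.

End faces.

(** * The kinetic energy flux *)

Section flux.
Context {R : realType} {d : nat} {J : finType} {I : set R}.
Variables (M : moving_mesh d J I) (rho : R).

(** When both states are [a], the arithmetic mean in the transporting velocity is
    [a] itself, and the averages of fluid and mesh velocity combine into that of
    the relative velocity. *)
Lemma ke_flux_consistent : consistent_ke_flux M rho (ke_flux M rho).
Proof.
move=> t i j a It ij.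
rewrite /ke_flux /exact_ke_flux /ke_density; congr (_ * _).
rewrite /face_velocity /face_mesh_velocity.
have -> : 2^-1 *: (a + a) = a.
  rewrite scalerDr -scalerDl (_ : 2^-1 + 2^-1 = 1) ?scale1r//.
  by field.
rewrite -face_averageB//; last 2 first.
- exact: integrable_dotp_normal.
- exact: mesh_velocity_integrable.
by congr (face_average M t i j _); apply/funext => x; rewrite dotpDl dotpNl.
Qed.

(** The transported density is symmetric in the two states, and the relative
    normal velocity changes sign with the normal. *)
Lemma ke_flux_antisymmetric : antisymmetric_flux M (ke_flux M rho).
Proof.
move=> t i j a b It ij.
have ji : adj M j i by rewrite (adjC M _ _ It).
rewrite /ke_flux /ke_density (dotpC a b) -[RHS]mulNr; congr (_ * _).
rewrite /face_velocity /face_mesh_velocity.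
have nN x : face M t j i x -> normal M t i j x = - normal M t j i x.
  by rewrite faceC; exact: normal_opp.
rewrite (addrC a b).
rewrite (@face_average_opp _ _ _ _ M t j i
  (fun x => dotp (2^-1 *: (b + a)) (normal M t j i x)))//; last 2 first.
- exact: integrable_dotp_normal.
- by move=> x /nN ->; rewrite dotpNr.
rewrite (@face_average_opp _ _ _ _ M t j i
  (fun x => dotp (mesh_velocity M t x) (normal M t j i x)))//; last 2 first.
- exact: mesh_velocity_integrable.
- by move=> x /nN ->; rewrite dotpNr.
by ring.
Qed.

End flux.

Theorem theorem3p1 (R : realType) (d : nat) (hd : d = 2%N \/ d = 3%N)
    (I : set R) (hIopen : open I) (hIint : is_interval I)
    (J : finType) (M : moving_mesh d J I)
    (rho : R) (hrho : 0 < rho)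
    (u : R -> J -> 'rV[R]_d)
    (hu : forall t i, I t -> derivable (u ^~ i) t 1)
    (hvol : forall t i, I t -> derivable (cell_volume M ^~ i) t 1)
    (hdiv : divergence_free M u)
    (hgcl : geometric_conservation_law M)
    (hscheme : ducros_scheme M rho u) :
  kinetic_energy_law M rho u
  /\ consistent_ke_flux M rho (ke_flux M rho)
  /\ (forall a b : 'rV[R]_d, ke_density rho a b = ke_density rho b a)
  /\ antisymmetric_flux M (ke_flux M rho).
Proof.
split; last first.
  split; first exact: ke_flux_consistent.
  split; last exact: ke_flux_antisymmetric.
  by move=> a b; rewrite /ke_density dotpC.
move=> t i It; rewrite derive1E.
have gcl := hgcl t i It; have scheme := hscheme t i It.
rewrite derive1E in gcl; rewrite derive1E in scheme.
exact: (kinetic_energy_balance (hvol t i It) (hu t i It) (hdiv t i It) gcl scheme).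
Qed.
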